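(* Let $V$ be a positive definite quadratic space over $\mathbb{Q}$ with symmetric bilinear form $b$, $\varphi(v)=b(v,v)$, and let $L=\mathbb{Z}v_1+\cdots+\mathbb{Z}v_n$ be a lattice with $\mathbb{Q}L=V$, of even rank $n$, with diagonal Gram matrix $\langle a_1,\dots,a_n\rangle$, $a_j$ positive integers, $\gcd(a_1,\dots,a_n)=1$. Let $c\in\mathbb{Z}$, $N\in\mathbb{Z}_{>0}$ with $\gcd(c,N)=1$, $\nu=-\frac{c}{N}(v_1+\cdots+v_n)$, $X=L+\nu$, and let $h\in\mathbb{Q}$ satisfy $h-\sum_{j=1}^n a_j(c/N)^2\in 8(\gcd(N,4)N)^{-1}\mathbb{Z}$. If $4\mid N$, then \[ b_2(h,\lambda,0)=2^{-(\mathrm{ord}_2N-1)}. \]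
   Context: For a prime $p$ let $V_p=V\otimes\mathbb{Q}_p$, $L_p=L\otimes\mathbb{Z}_p$, $X_p=L_p+\nu$, and $\lambda_p$ the characteristic function of $X_p$. For $z\in\mathbb{Q}_p$, $\mathbf{e}_p(z):=e^{-2\pi i y}$ where $y\in\mathbb{Z}[1/p]$ with $z-y\in\mathbb{Z}_p$. Haar measures: $\int_{L_p}dv=1$ on $V_p$ and $\int_{\mathbb{Z}_p}d\sigma=1$ on $\mathbb{Q}_p$. The local density is $b_p(h,\lambda,0):=\int_{\mathbb{Q}_p}\int_{V_p}\mathbf{e}_p(\sigma(\varphi(v)-h))\lambda_p(v)\,dv\,d\sigma$. *)

(* Defs.v *)
From HB Require Import structures.
From mathcomp Require Import all_boot all_order all_algebra fraction.
From mathcomp Require Import all_classical all_reals all_analysis.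
From mathcomp Require Import complex.
From mathcomp Require Import sesquilinear.

Set Implicit Arguments.
Unset Strict Implicit.
Unset Printing Implicit Defensive.

Import Order.TTheory GRing.Theory Num.Theory.

Local Open Scope classical_set_scope.
Local Open Scope ring_scope.

Record prime_nat := PrimeNat { prime_val :> nat; prime_valP : prime prime_val }.

Definition prime2 : prime_nat := @PrimeNat 2 isT.

(* Z_p as the inverse limit of the rings Z/p^k: an element is the sequence of *)
(* its least nonnegative residues mod p^k, so that each residue is the        *)
(* reduction of the next one.                                                 *)
Record padic_int (p : prime_nat) := PadicInt {
  residue :> nat -> int;
  residueP : forall k, residue k = (residue k.+1 %% (p : nat)%:Z ^+ k)%Z }.

Section PadicInt.
Variable p : prime_nat.
Local Notation Zp := (padic_int p).
Local Notation q k := ((p : nat)%:Z ^+ k).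

HB.instance Definition _ := gen_eqMixin Zp.
HB.instance Definition _ := gen_choiceMixin Zp.

Implicit Types x y z : Zp.

Lemma padic_intP x y : (forall k, x k = y k) -> x = y.
Proof.
case: x y => [f fP] [g gP] /= /funext fg; rewrite fg in fP *.
by rewrite (Prop_irrelevance fP gP).
Qed.

Lemma modz_dvdm (m d e : int) : (d %| e)%Z -> ((m %% e)%Z %% d)%Z = (m %% d)%Z.
Proof.
move=> /dvdzP[c ->]; apply/eqP; rewrite eqz_mod_dvd.
have := divz_eq m (c * d); rewrite addrC => /eqP; rewrite -subr_eq => /eqP <-.
by rewrite addrAC subrr add0r mulrA rpredN dvdz_mull.
Qed.

Lemma q_dvd k : (q k %| q k.+1)%Z.
Proof. by rewrite exprS dvdz_mull. Qed.

Lemma residue_mod x k : (x k %% q k)%Z = x k.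
Proof. by rewrite residueP modz_mod. Qed.

Lemma residueS x k : (x k.+1 = x k %[mod q k])%Z.
Proof. by rewrite [x k]residueP modz_mod. Qed.

Lemma limit_subproof (f : nat -> int) :
  (forall k, (f k.+1 = f k %[mod q k])%Z) ->
  forall k, (f k %% q k)%Z = ((f k.+1 %% q k.+1)%Z %% q k)%Z.
Proof. by move=> fP k; rewrite modz_dvdm ?q_dvd// fP. Qed.

Definition padic_limit (f : nat -> int)
    (fP : forall k, (f k.+1 = f k %[mod q k])%Z) : Zp :=
  PadicInt (limit_subproof fP).

Definition padic_zero : Zp := @padic_limit (fun=> 0) (fun=> erefl).
Definition padic_one : Zp := @padic_limit (fun=> 1) (fun=> erefl).

Lemma padic_opp_subproof x k : (- x k.+1 = - x k %[mod q k])%Z.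
Proof. by rewrite -modzNm residueS modzNm. Qed.
Definition padic_opp x : Zp := padic_limit (padic_opp_subproof x).

Lemma padic_add_subproof x y k :
  (x k.+1 + y k.+1 = x k + y k %[mod q k])%Z.
Proof. by rewrite -modzDm !residueS modzDm. Qed.
Definition padic_add x y : Zp := padic_limit (padic_add_subproof x y).

Lemma padic_mul_subproof x y k :
  (x k.+1 * y k.+1 = x k * y k %[mod q k])%Z.
Proof. by rewrite -modzMm !residueS modzMm. Qed.
Definition padic_mul x y : Zp := padic_limit (padic_mul_subproof x y).

Lemma padic_addA : associative padic_add.
Proof. by move=> x y z; apply: padic_intP => k /=; rewrite modzDmr modzDml addrA. Qed.

Lemma padic_addC : commutative padic_add.
Proof. by move=> x y; apply: padic_intP => k /=; rewrite addrC. Qed.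

Lemma padic_add0 : left_id padic_zero padic_add.
Proof. by move=> x; apply: padic_intP => k /=; rewrite modzDml add0r residue_mod. Qed.

Lemma padic_addN : left_inverse padic_zero padic_opp padic_add.
Proof. by move=> x; apply: padic_intP => k /=; rewrite modzDml addNr. Qed.

HB.instance Definition _ :=
  GRing.isZmodule.Build Zp padic_addA padic_addC padic_add0 padic_addN.

Lemma padic_mulA : associative padic_mul.
Proof. by move=> x y z; apply: padic_intP => k /=; rewrite modzMmr modzMml mulrA. Qed.

Lemma padic_mulC : commutative padic_mul.
Proof. by move=> x y; apply: padic_intP => k /=; rewrite mulrC. Qed.

Lemma padic_mul1 : left_id padic_one padic_mul.
Proof. by move=> x; apply: padic_intP => k /=; rewrite modzMml mul1r residue_mod. Qed.

Lemma padic_mulD : left_distributive padic_mul padic_add.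
Proof.
by move=> x y z; apply: padic_intP => k /=; rewrite modzMml modzDm mulrDl.
Qed.

Lemma padic_one_neq0 : padic_one != padic_zero.
Proof.
apply/eqP => /(congr1 (fun x : Zp => x 1)) /=.
rewrite mod0z expr1 modz_small ?ler01//= ltz_nat.
exact: prime_gt1 (prime_valP p).
Qed.

HB.instance Definition _ := GRing.Zmodule_isComNzRing.Build Zp
  padic_mulA padic_mulC padic_mul1 padic_mulD padic_one_neq0.

Definition padic_unit : {pred Zp} := fun x => `[< exists y, y * x = 1 >].
Definition padic_inv x : Zp := xget x [set y | y * x = 1].

Lemma padic_mulV : {in padic_unit, left_inverse 1 padic_inv *%R}.
Proof.
move=> x /asboolP[y yx]; rewrite /padic_inv.
by case: xgetP => [z _ //|/(_ y)]; rewrite /= yx.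
Qed.

Lemma padic_unitP x y : y * x = 1 -> padic_unit x.
Proof. by move=> yx; apply/asboolP; exists y. Qed.

Lemma padic_inv_out : {in [predC padic_unit], padic_inv =1 id}.
Proof.
move=> x /negP xU; rewrite /padic_inv.
by case: xgetP => // z _ /= zx; case: xU; exact: padic_unitP zx.
Qed.

HB.instance Definition _ := GRing.ComNzRing_hasMulInverse.Build Zp
  padic_mulV padic_unitP padic_inv_out.

Lemma residue_addk x k j : (x (k + j)%N = x k %[mod q k])%Z.
Proof.
elim: j => [|j IH]; first by rewrite addn0.
rewrite addnS -IH -(modz_dvdm (x (k + j).+1) (e := q (k + j))).
  by rewrite residueS modz_dvdm // exprD dvdz_mulr.
by rewrite exprD dvdz_mulr.
Qed.

Lemma padic_integral : GRing.integral_domain_axiom Zp.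
Proof.
move=> x y xy0; apply: contrapT => /negP; rewrite negb_or.
move=> /andP[/eqP x0 /eqP y0].
have nz z : z <> 0 -> exists k, ~~ (q k %| z k)%Z.
  move=> z0; apply: contrapT => /forallNP h; apply: z0; apply: padic_intP => k.
  have /negP := h k; rewrite negbK => /dvdz_mod0P.
  by rewrite residue_mod => -> /=; rewrite mod0z.
have [k kx] := nz _ x0; have [l ly] := nz _ y0.
have kx' : ~~ (q k %| x (k + l)%N)%Z.
  by apply: contra kx => /dvdz_mod0P; rewrite residue_addk => h; apply/dvdz_mod0P.
have ly' : ~~ (q l %| y (k + l)%N)%Z.
  by apply: contra ly => /dvdz_mod0P; rewrite addnC residue_addk => h; apply/dvdz_mod0P.
have := congr1 (fun x : Zp => x (k + l)%N) xy0; rewrite /= mod0z => /dvdz_mod0P.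
move: kx' ly'; rewrite !dvdzE abszM !abszX !absz_nat.
set m := absz _; set m' := absz _ => km lm.
have p_pr := prime_valP p.
have m0 : (0 < m)%N by rewrite lt0n; apply: contra km => /eqP ->; rewrite dvdn0.
have m0' : (0 < m')%N by rewrite lt0n; apply: contra lm => /eqP ->; rewrite dvdn0.
move: km lm; rewrite !pfactor_dvdn ?muln_gt0 ?m0 ?m0'// -!ltnNge lognM// => km lm.
by rewrite leqNgt -addSn leq_add// ltnW.
Qed.

HB.instance Definition _ := GRing.ComUnitRing_isIntegral.Build Zp padic_integral.

End PadicInt.

Definition padic (p : prime_nat) : Type := {fraction (padic_int p)}.

HB.instance Definition _ (p : prime_nat) := GRing.Field.on (padic p).
HB.instance Definition _ (p : prime_nat) := isPointed.Build (padic p) 0.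

Definition of_padic_int (p : prime_nat) (x : padic_int p) : padic p :=
  @FracField.tofrac (padic_int p) x.

Definition padic_integers (p : prime_nat) : set (padic p) :=
  range (@of_padic_int p).
Arguments padic_integers p : clear implicits.

(* The p-adic topology: the cosets x + p^k Z_p form a neighborhood basis at x. *)
Section PadicTopology.
Variable p : prime_nat.

Definition padic_open : set_system (padic p) := [set U | forall x, U x ->
  exists k : nat, forall z, padic_integers p z -> U (x + p%:R ^+ k * z)].

Lemma padic_openT : padic_open setT.
Proof. by move=> x _; exists 0%N. Qed.

Lemma of_padic_intM_nat k z :
  padic_integers p z -> padic_integers p ((p%:R : padic p) ^+ k * z).
Proof.
move=> [w _ <-]; exists (p%:R ^+ k * w) => //.
by rewrite /of_padic_int rmorphM rmorphXn rmorph_nat.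
Qed.

Lemma padic_openI : setI_closed padic_open.
Proof.
move=> A B Ao Bo x [/Ao[k kA] /Bo[l lB]]; exists (k + l)%N => z Zz; split.
  by rewrite exprD -mulrA; apply: kA; exact: of_padic_intM_nat.
by rewrite addnC exprD -mulrA; apply: lB; exact: of_padic_intM_nat.
Qed.

Lemma padic_open_bigU (I : Type) (f : I -> set (padic p)) :
  (forall i, padic_open (f i)) -> padic_open (\bigcup_i f i).
Proof.
by move=> fo x [i _ /fo[k fk]]; exists k => z /fk fz; exists i.
Qed.

HB.instance Definition _ := isOpenTopological.Build (padic p)
  padic_openT padic_openI padic_open_bigU.

End PadicTopology.

Definition borel (T : ptopologicalType) := g_sigma_algebraType (@open T).
HB.instance Definition _ (T : ptopologicalType) := Measurable.on (borel T).

(* Haar measures on a second countable locally compact group with law [op],  *)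
(* where the usual regularity conditions are automatic.                       *)
Definition haar_measure (R : realType) (T : ptopologicalType)
    (mu : {measure set (borel T) -> \bar R}) (op : T -> T -> T) : Prop :=
  [/\ forall (x : T) (A : set (borel T)), measurable A ->
        mu [set op x y | y in A] = mu A,
      forall K : set T, compact K -> (mu K < +oo)%E &
      mu setT <> 0%E].

(* V tensor Q_p, in coordinates along the basis [vbasis {:V}] of V. *)
Notation localization p V := 'rV[padic p]_(\dim {:V}).

Section LocalDensity.
Variables (R : realType) (p : prime_nat) (V : vectType rat).
Local Notation Vp := (localization p V).

(* v |-> v tensor 1 *)
Definition to_localization (v : V) : Vp :=
  \row_i ratr (coord (vbasis {:V}) i v).

Definition local_form (b : V -> V -> rat) (x y : Vp) : padic p :=
  \sum_i \sum_j x 0 i * y 0 j * ratr (b (vbasis {:V})`_i (vbasis {:V})`_j).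

(* The image of L tensor Z_p: the Z_p-submodule generated by L. *)
Definition local_lattice (L : set V) : set Vp :=
  [set w | exists (m : nat) (z : 'I_m -> padic_int p) (l : 'I_m -> V),
     (forall i, L (l i)) /\
     w = \sum_i of_padic_int (z i) *: to_localization (l i)].

Definition local_coset (L : set V) (nu : V) : set Vp :=
  [set w + to_localization nu | w in local_lattice L].

(* A representative y in Z[1/p] of z modulo Z_p. *)
Definition padic_frac (z : padic p) : rat :=
  xget 0 [set y : rat | (exists (m : int) (k : nat), y = m%:~R / p%:R ^+ k) /\
                        padic_integers p (z - ratr y)].

(* exp (- 2 pi i y) for y = padic_frac z *)
Definition padic_char (z : padic p) : R[i] :=
  let t : R := 2 * pi * ratr (padic_frac z) in Complex (cos t) (- sin t).

Definition cintegral d (T : measurableType d)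
    (mu : {measure set T -> \bar R}) (f : T -> R[i]) : R[i] :=
  Complex (\int[mu]_x complex.Re (f x)) (\int[mu]_x complex.Im (f x)).

Definition local_density (b : V -> V -> rat) (h : rat) (lambda : Vp -> R[i])
    (muV : {measure set (borel Vp) -> \bar R})
    (muQ : {measure set (borel (padic p)) -> \bar R}) : R[i] :=
  cintegral muQ (fun s : padic p =>
    cintegral muV (fun v : Vp =>
      padic_char (s * (local_form b v v - ratr h)) * lambda v)).

End LocalDensity.

Definition int_span (V : vectType rat) n (v : n.-tuple V) : set V :=
  [set u | exists k : 'I_n -> int, u = \sum_i tnth v i *~ k i].

Definition char_fun (R : realType) (T : Type) (A : set T) (x : T) : R[i] :=
  real_complex R (\1_A x).

Arguments to_localization p {V} v.
Arguments local_lattice p {V} L.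
Arguments local_coset p {V} L nu.

(* Main.v *)
From HB Require Import structures.
Require Import Defs.
From mathcomp Require Import all_boot all_order all_algebra.
From mathcomp Require Import fraction generic_quotient.
From mathcomp Require Import all_classical all_reals all_analysis.
From mathcomp Require Import measurable_realfun.
From mathcomp Require Import complex sesquilinear.
From mathcomp Require Import ring zify.

(** Put [M = N / 2] and [t = s / M], where [s] is the outer variable.  By the
    congruence on [h], [M (phi(v) - h)] is a 2-adic integer for every [v] in the
    coset, so for [t] in [Z_2] the character is trivial and the inner integral
    is the volume of the coset, namely 1.  Otherwise let [m] be minimal with
    [2^(m+1) t] in [Z_2], and pick [j] with [a_j] odd.  As [M] is even and [c]
    is odd, translating [v] by [2^m v_j] changes [M (phi(v) - h)] by [2^m] times
    an odd 2-adic integer, hence changes [s (phi(v) - h)] by [1/2] modulo [Z_2]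
    and flips the sign of the character; translation invariance then makes the
    inner integral vanish.  The outer integral is therefore the volume of
    [M Z_2], which is [2^(1 - ord_2 N)]. *)

Import Order.TTheory GRing.Theory Num.Theory.
Local Open Scope classical_set_scope.
Local Open Scope ring_scope.

(** * Residues, divisibility by powers of [p] and units among the p-adic integers *)

Section PadicInt.
Variable p : prime_nat.
Local Notation Zp := (padic_int p).
Local Notation q k := ((p : nat)%:Z ^+ k).
Implicit Types x y : Zp.

Let q_gt0 k : 0 < q k.
Proof. by rewrite exprn_gt0// ltz_nat prime_gt0// prime_valP. Qed.

Lemma residueD x y k : (x + y) k = ((x k + y k) %% q k)%Z.
Proof. by []. Qed.

Lemma residueM x y k : (x * y) k = ((x k * y k) %% q k)%Z.
Proof. by []. Qed.

Lemma residueN x k : (- x) k = ((- x k) %% q k)%Z.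
Proof. by []. Qed.

Lemma residue_int (m : int) k : (m%:~R : Zp) k = (m %% q k)%Z.
Proof.
have nE n : (n%:R : Zp) k = (n%:Z %% q k)%Z.
  elim: n => [|n IH]; first by rewrite /= mod0z.
  by rewrite mulrS addrC residueD IH modzDm intS addrC.
case: m => n; first by rewrite -nE.
by rewrite NegzE mulrNz residueN -pmulrn nE modzNm.
Qed.

Lemma residue0 x : x 0%N = 0.
Proof. by rewrite -residue_mod expr0 modz1. Qed.

Lemma residue_shift x j k : (x (k + j)%N %% q k)%Z = x k.
Proof. by rewrite residue_addk residue_mod. Qed.

(** All later residues [x (k + j)] are divisible by [p ^ k], and their quotients are the residues of
    [y]. They are compatible because a congruence modulo [p ^ (k + j)] between multiples of [p ^ k]
    may be divided by [p ^ k]. *)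
Lemma residue_eq0_dvd x k : x k = 0 -> exists y, x = p%:R ^+ k * y.
Proof.
move=> xk0.
have dvdx j : (q k %| x (k + j)%N)%Z by apply/dvdz_mod0P; rewrite residue_shift.
have qy j : (x (k + j)%N %/ q k)%Z * q k = x (k + j)%N by rewrite divzK.
have yP j : ((x (k + j.+1)%N %/ q k)%Z = (x (k + j)%N %/ q k)%Z %[mod q j])%Z.
  apply/eqP; rewrite eqz_mod_dvd -(@dvdz_mul2r (q k)) ?gt_eqF ?q_gt0//.
  rewrite mulrBl !qy -exprD (addnC j k) -eqz_mod_dvd.
  by rewrite addnS residueS.
exists (padic_limit yP); apply: padic_intP => j.
have -> : (p%:R ^+ k : Zp) = (q k)%:~R by rewrite rmorphXn.
rewrite residueM residue_int /= modzMm mulrC qy addnC.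
by rewrite residue_shift.
Qed.

Lemma padic_int_split x k : exists y, x = (x k)%:~R + p%:R ^+ k * y.
Proof.
have [|y xE] := @residue_eq0_dvd (x - (x k)%:~R) k.
  by rewrite residueD residueN residue_int modzNm modzDmr subrr mod0z.
by exists y; rewrite -xE addrC subrK.
Qed.

(** Every residue [x k] is prime to [p], so Bezout inverts it modulo [p ^ k]. Uniqueness of inverses
    modulo [p ^ k] makes these inverses a compatible sequence. *)
Lemma padic_int_unit x : x 1%N != 0 -> exists y, y * x = 1.
Proof.
move=> x1.
have cop k : coprimez (x k) (q k).
  rewrite /coprimez eq_sym.
  case: k => [|k]; first by rewrite residue0 expr0.
  rewrite eqz_nat eq_sym -[_ == _]/(coprime _ _) abszX absz_nat coprimeXr//.
  rewrite coprime_sym prime_coprime ?prime_valP//.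
  apply: contra x1 => px; have := residue_shift x k 1.
  rewrite add1n => <-; apply/eqP/dvdz_mod0P.
  by rewrite expr1 dvdzE absz_nat.
have /choice[f fP] : forall k, exists u : int, ((u * x k)%R = 1 %[mod q k])%Z.
  move=> k; have /coprimezP[[u w] /= uw] := cop k.
  exists u; apply/eqP; rewrite eqz_mod_dvd; apply/dvdzP; exists (- w).
  by rewrite -[X in _ - X]uw mulNr opprD addNKr.
have fS k : (f k.+1 = f k %[mod q k])%Z.
  have e1 : ((f k.+1 * x k)%R = 1 %[mod q k])%Z.
    rewrite -modzMmr -residueS modzMmr -(@modz_dvdm (f _ * _) _ (q k.+1)) ?q_dvd//.
    by rewrite fP modz_dvdm// q_dvd.
  rewrite -[f k.+1]mulr1 -modzMmr -(fP k) modzMmr mulrCA.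
  by rewrite -modzMmr e1 modzMmr mulr1.
exists (padic_limit fS); apply: padic_intP => k.
by rewrite residueM /= modzMml fP.
Qed.

(** The exponent is the valuation of [x], found as one less than the first index with a nonzero
    residue. If the cofactor were divisible by [p], the residue at that index would vanish. *)
Lemma padic_int_factor x : x != 0 ->
  exists k y z, z * y = 1 /\ x = p%:R ^+ k * y.
Proof.
move=> x0.
have ex : exists k, x k != 0.
  apply: contrapT => /forallNP h; move/eqP: x0; apply; apply: padic_intP => k.
  by have /negP := h k; rewrite negbK => /eqP -> /=; rewrite mod0z.
(* The residue at index 0 is taken modulo 1, hence is 0, so the first nonzero one has a successor
   index. *)
case: (ex_minnP ex) => -[|k]; first by rewrite residue0 eqxx.
move=> xk kmin.
have [|y xE] := @residue_eq0_dvd x k.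
  by apply/eqP; apply: contraT => /kmin; rewrite ltnn.
have [z zy] : exists z, z * y = 1.
  apply: padic_int_unit; apply: contra xk => /eqP y1.
  have [w yE] := @residue_eq0_dvd _ _ y1.
  rewrite xE yE mulrA -exprD addn1.
  have -> : (p%:R ^+ k.+1 : Zp) = (q k.+1)%:~R by rewrite rmorphXn.
  by rewrite residueM residue_int modzz mul0r mod0z.
by exists k, y, z.
Qed.

End PadicInt.
Arguments padic_int_split {p} x k.

(** * The embedding [ratr] of the rationals into a field of characteristic zero *)

Section RatrChar0.
Variable F : fieldType.
Hypothesis F0 : forall n : nat, n.+1%:R != 0 :> F.

Lemma intr_char0_eq0 (m : int) : (m%:~R == 0 :> F) = (m == 0).
Proof.
case: m => [[|m]|m]; first by rewrite mulr0z !eqxx.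
  by rewrite -pmulrn (negbTE (F0 m)).
by rewrite NegzE mulrNz oppr_eq0 -pmulrn (negbTE (F0 m)).
Qed.

(** [ratr] uses the reduced numerator and denominator. Cross-multiplication turns the comparison
    with an arbitrary fraction into an equality of integers, which transfers between [rat] and
    [F]. *)
Lemma ratr_char0_frac (m d : int) : d != 0 ->
  ratr (m%:~R / d%:~R) = m%:~R / d%:~R :> F.
Proof.
move=> d0; rewrite /ratr; set x := m%:~R / d%:~R.
apply/eqP; rewrite eqr_div ?intr_char0_eq0 ?denq_eq0//.
rewrite -!intrM -subr_eq0 -intrB intr_char0_eq0 subr_eq0.
rewrite -(eqr_int rat) !intrM.
have := divq_num_den x; rewrite {3}/x => /eqP.
by rewrite eqr_div ?intr_eq0 ?denq_eq0.
Qed.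

Lemma ratr_char0D x y : ratr (x + y) = ratr x + ratr y :> F.
Proof.
rewrite -[x]divq_num_den -[y]divq_num_den.
rewrite addf_div ?intr_eq0 ?denq_eq0// -!intrM -intrD.
rewrite !ratr_char0_frac ?mulf_neq0 ?denq_eq0//.
by rewrite addf_div ?intr_char0_eq0 ?denq_eq0// !intrD !intrM.
Qed.

Lemma ratr_char0M x y : ratr (x * y) = ratr x * ratr y :> F.
Proof.
rewrite -[x]divq_num_den -[y]divq_num_den.
rewrite mulf_div -!intrM.
rewrite !ratr_char0_frac ?mulf_neq0 ?denq_eq0//.
by rewrite mulf_div !intrM.
Qed.

Lemma ratr_char0N x : ratr (- x) = - ratr x :> F.
Proof.
by rewrite -mulN1r ratr_char0M -[-1](rmorphN1 (intmul 1)) ratr_int mulN1r.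
Qed.

Lemma ratr_char0B x y : ratr (x - y) = ratr x - ratr y :> F.
Proof. by rewrite ratr_char0D ratr_char0N. Qed.

Lemma ratr_char0_sum (I : Type) (r : seq I) (f : I -> rat) :
  ratr (\sum_(i <- r) f i) = \sum_(i <- r) ratr (f i) :> F.
Proof. by apply: (big_morph _ ratr_char0D); rewrite (ratr_nat F 0). Qed.

End RatrChar0.

(** A representing pair of [z] provides [x] and [w]; the equation [z * w = x] is then checked on
    representatives in the quotient. *)
Lemma fraction_numden (A : idomainType) (z : {fraction A}) :
  exists x w : A, w != 0 /\ z = FracField.tofrac x / FracField.tofrac w.
Proof.
elim/quotW: z => r; exists (frac r).1, (frac r).2; split; first exact: denom_ratioP.
set z := (X in X = _).
have w0 : FracField.tofrac (frac r).2 != 0 by rewrite tofrac_eq0 denom_ratioP.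
apply: (mulIf w0); rewrite mulfVK//.
rewrite /z; unlock FracField.tofrac.
rewrite -[LHS]FracField.pi_mul; apply/eqmodP.
rewrite /= FracField.equivfE /FracField.mulf.
by rewrite !numden_Ratio ?(oner_neq0, mulf_neq0, denom_ratioP)// !mulr1 mulrC.
Qed.

(** * The field of p-adic numbers and its subring of integers *)

Section Padic.
Variable p : prime_nat.
Local Notation Qp := (padic p).
Local Notation Zp := (padic_integers p).
Local Notation q k := ((p : nat)%:Z ^+ k).

HB.instance Definition _ := GRing.RMorphism.copy (@of_padic_int p)
  (@FracField.tofrac (padic_int p)).

Lemma padic_integersD x y : Zp x -> Zp y -> Zp (x + y).
Proof. by move=> [u _ <-] [w _ <-]; exists (u + w); rewrite ?rmorphD. Qed.

Lemma padic_integersM x y : Zp x -> Zp y -> Zp (x * y).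
Proof. by move=> [u _ <-] [w _ <-]; exists (u * w); rewrite ?rmorphM. Qed.

Lemma padic_integersN x : Zp x -> Zp (- x).
Proof. by move=> [u _ <-]; exists (- u); rewrite ?rmorphN. Qed.

Lemma padic_integersB x y : Zp x -> Zp y -> Zp (x - y).
Proof. by move=> Zx Zy; apply: padic_integersD => //; exact: padic_integersN. Qed.

Lemma padic_integers_int (m : int) : Zp m%:~R.
Proof. by exists m%:~R; rewrite ?rmorph_int. Qed.

Lemma padic_integers_nat (m : nat) : Zp m%:R.
Proof. exact: padic_integers_int m. Qed.

Lemma padic_integersX k x : Zp x -> Zp (x ^+ k).
Proof. by move=> [u _ <-]; exists (u ^+ k); rewrite ?rmorphXn. Qed.

Lemma padic_integers_of x : Zp (of_padic_int x).
Proof. by exists x. Qed.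

Lemma padic_integers_sum (I : Type) (r : seq I) (f : I -> Qp) :
  (forall i, Zp (f i)) -> Zp (\sum_(i <- r) f i).
Proof.
by move=> Zf; apply: big_ind => //; [exact: padic_integers_nat 0|exact: padic_integersD].
Qed.

Lemma of_padic_int_inj : injective (@of_padic_int p).
Proof. by move=> x y /eqP; rewrite tofrac_eq => /eqP. Qed.

(** Since [n + 1 < p ^ (n + 1)], the residue of [n + 1] at index [n + 1] is [n + 1] itself. *)
Lemma padic_natS_neq0 n : n.+1%:R != 0 :> Qp.
Proof.
rewrite -(rmorph_nat (@of_padic_int p)) tofrac_eq0; apply/eqP.
move=> /(congr1 (fun x : padic_int p => x n.+1)).
rewrite (residue_int p n.+1) /= mod0z modz_small//.
apply/andP; split=> //; rewrite -!natz -natrX ltr_nat.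
by rewrite ltn_expl// prime_gt1// prime_valP.
Qed.

Lemma padic_p_neq0 k : p%:R ^+ k != 0 :> Qp.
Proof.
rewrite expf_eq0 negb_and; apply/orP; right.
by have := prime_gt0 (prime_valP p); case: (p : nat) => // m _; exact: padic_natS_neq0.
Qed.

(** The denominator of [z] is a power of [p] times a unit; only the power of [p] has to be
    cleared. *)
Lemma padic_integers_scale (z : Qp) : exists k, Zp (p%:R ^+ k * z).
Proof.
have [x [w [w0 ->]]] : exists x w : padic_int p,
    w != 0 /\ z = of_padic_int x / of_padic_int w.
  exact: fraction_numden.
have [k [u [u' [u'u ->]]]] := @padic_int_factor p _ w0.
exists k, (x * u') => //.
have u0 : of_padic_int u != 0.
  rewrite tofrac_eq0; apply: contra_eq_neq u'u => ->.
  by rewrite mulr0 eq_sym oner_neq0.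
rewrite [of_padic_int (_ * u)]rmorphM rmorphXn rmorph_nat.
rewrite [LHS]rmorphM; apply: (mulIf u0); rewrite -mulrA -rmorphM u'u rmorph1 mulr1.
by rewrite invfM mulrCA (mulVKf (padic_p_neq0 k)) mulfVK.
Qed.

(** If the quotient is [x], then [m = x * p ^ k], whose residue at index [k] vanishes. *)
Lemma padic_integers_intV (m : int) k :
  Zp (m%:~R / p%:R ^+ k) -> (q k %| m)%Z.
Proof.
move=> [x _ /(canLR (mulfVK (padic_p_neq0 k)))].
rewrite -(rmorph_nat (@of_padic_int p)) -rmorphXn -rmorphM.
rewrite -(rmorph_int (@of_padic_int p)) => /of_padic_int_inj.
move=> /(congr1 (fun x : padic_int p => x k)).
have -> : (p%:R ^+ k : padic_int p) = (q k)%:~R by rewrite rmorphXn.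
rewrite residueM !residue_int modzz mulr0 mod0z => /esym.
by move/dvdz_mod0P.
Qed.

End Padic.

Section PadicRatr.
Variable p : prime_nat.
Let p0 : forall n : nat, n.+1%:R != 0 :> padic p := @padic_natS_neq0 p.

Definition padic_ratrD := ratr_char0D _ p0.
Definition padic_ratrM := ratr_char0M _ p0.
Definition padic_ratrN := ratr_char0N _ p0.
Definition padic_ratrB := ratr_char0B _ p0.
Definition padic_ratr_sum := ratr_char0_sum _ p0.
Definition padic_ratr_frac := ratr_char0_frac _ p0.

End PadicRatr.

(** * The additive character, its independence of representatives and its sign change *)

Section PadicChar.
Variables (R : realType) (p : prime_nat).
Local Notation Qp := (padic p).
Local Notation Zp := (padic_integers p).
Local Notation q k := ((p : nat)%:Z ^+ k).

(** This is membership in [Z[1/p]], in the form in which it occurs inside [padic_frac]. *)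
Definition pfrac (y : rat) : Prop := exists (m : int) (k : nat), y = m%:~R / p%:R ^+ k.

Let p_neq0 (F : numFieldType) k : (p%:R ^+ k : F) != 0.
Proof.
rewrite expf_eq0 negb_and pnatr_eq0; apply/orP; right.
by rewrite -lt0n prime_gt0// prime_valP.
Qed.

Lemma pfracD x y : pfrac x -> pfrac y -> pfrac (x + y).
Proof.
move=> [m [k ->]] [m' [k' ->]]; exists (m * q k' + m' * q k), (k + k')%N.
by rewrite addf_div ?p_neq0// exprD intrD !intrM !rmorphXn.
Qed.

Lemma pfracN x : pfrac x -> pfrac (- x).
Proof. by move=> [m [k ->]]; exists (- m), k; rewrite mulrNz mulNr. Qed.

Lemma pfrac0 : pfrac 0.
Proof. by exists 0, 0%N; rewrite mul0r. Qed.

Lemma ratr_pfrac (m : int) k :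
  ratr (m%:~R / p%:R ^+ k) = m%:~R / p%:R ^+ k :> Qp.
Proof.
have e (F : fieldType) : (p%:R ^+ k : F) = (q k)%:~R by rewrite rmorphXn.
rewrite !e padic_ratr_frac//.
rewrite expf_eq0 negb_and; apply/orP; right.
by rewrite eqz_nat -lt0n prime_gt0// prime_valP.
Qed.

Lemma pfrac_integral y : pfrac y -> Zp (ratr y) -> exists i : int, y = i%:~R.
Proof.
move=> [m [k ->]]; rewrite ratr_pfrac => /padic_integers_intV /dvdzP[i ->].
by exists i; rewrite intrM rmorphXn/= mulfK ?p_neq0.
Qed.

Lemma padic_fracP (z : Qp) : pfrac (padic_frac z) /\ Zp (z - ratr (padic_frac z)).
Proof.
apply: (@xgetPex _ 0 [set y : rat | pfrac y /\ Zp (z - ratr y)]).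
have [k [x _ xE]] := padic_integers_scale p z.
have [w] := padic_int_split x k; move: (x k) => r xw.
(* Here [r] is the residue modulo [p ^ k] of the integer [p ^ k * z], so subtracting [r / p ^ k]
   from [z] leaves the p-adic integer [w]. *)
exists (r%:~R / p%:R ^+ k); split; first by exists r, k.
exists w => //; apply: (mulfI (padic_p_neq0 p k)).
rewrite ratr_pfrac mulrBr (mulrC _ (_ / _)) (mulfVK (padic_p_neq0 p k)) -xE xw.
by rewrite rmorphD rmorph_int rmorphM rmorphXn rmorph_nat addrAC subrr add0r.
Qed.

(** Two representatives differ by an element of [Z[1/p]] that is a p-adic integer, hence by an
    ordinary integer. *)
Lemma padic_frac_unique (z : Qp) y : pfrac y -> Zp (z - ratr y) ->
  exists i : int, padic_frac z = y + i%:~R.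
Proof.
move=> fy Zy; have [fz Zz] := padic_fracP z.
have [||i iE] := @pfrac_integral (padic_frac z - y).
- by apply: pfracD => //; exact: pfracN.
- have e : ratr (padic_frac z) - ratr y = z - ratr y - (z - ratr (padic_frac z)).
    by rewrite opprB [RHS]addrC addrA subrK.
  by rewrite padic_ratrB e; exact: padic_integersB.
by exists i; rewrite -iE addrC subrK.
Qed.

Lemma periodic_int (f : R -> R) T : periodic f T ->
  forall x (i : int), f (x + T * i%:~R) = f x.
Proof.
move=> fT x [n|n]; first by rewrite -pmulrn mulr_natr periodicn.
rewrite NegzE mulrNz mulrN -pmulrn mulr_natr.
by rewrite -[LHS](periodicn fT n.+1) subrK.
Qed.

(** Periodicity of [cos] and [sin] absorbs the integer by which [y] differs from the representative
    chosen by [padic_frac]. *)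
Lemma padic_charE (z : Qp) y : pfrac y -> Zp (z - ratr y) ->
  padic_char R z = Complex (cos (2 * pi * ratr y)) (- sin (2 * pi * ratr y)).
Proof.
move=> fy Zy; have [i iE] := padic_frac_unique _ _ fy Zy.
rewrite /padic_char iE rmorphD/= ratr_int mulrDr -[2 * pi]mulrC.
have -> : pi * 2 = pi *+ 2 :> R by rewrite mulr_natr.
by rewrite (periodic_int _ _ (@cosD2pi R)) (periodic_int _ _ (@sinD2pi R)).
Qed.

Lemma padic_char_int (z : Qp) : Zp z -> padic_char R z = 1.
Proof.
move=> Zz; rewrite (@padic_charE _ 0).
- by rewrite rmorph0 mulr0 cos0 sin0 oppr0.
- exact: pfrac0.
- by rewrite (ratr_nat _ 0) subr0.
Qed.

Lemma padic_charD_int (z w : Qp) : Zp w -> padic_char R (z + w) = padic_char R z.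
Proof.
move=> Zw; have [fz Zz] := padic_fracP z; rewrite (padic_charE _ _ fz)//.
by rewrite addrAC; exact: padic_integersD.
Qed.

End PadicChar.

(** Modulo integers [w] is [1/2], which moves the angle by [pi]. *)
Lemma padic2_charD_half (R : realType) (z w : padic prime2) :
  padic_integers prime2 (w - 2^-1) ->
  padic_char R (z + w) = - padic_char R z.
Proof.
move=> Zw; have [fz Zz] := padic_fracP _ z.
have h : pfrac prime2 (2^-1) by exists 1, 1%N; rewrite mul1r expr1.
rewrite (@padic_charE _ _ _ (padic_frac z + 2^-1)).
- rewrite rmorphD/= fmorphV/= (ratr_nat _ 2) mulrDr.
  rewrite [X in cos (_ + X)]mulrAC [X in sin (_ + X)]mulrAC divff ?pnatr_eq0//.
  by rewrite mul1r /padic_char cosDpi sinDpi.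
- exact: pfracD.
- rewrite padic_ratrD opprD addrACA; apply: padic_integersD => //.
  have -> : ratr (2^-1) = 2^-1 :> padic prime2.
    have := ratr_pfrac prime2 1 1.
    by rewrite !mul1r !expr1.
  by [].
Qed.

(** * Open sets of row vectors over the p-adic field *)

Section RowTopology.
Variables (p : prime_nat) (d : nat).
Local Notation T := 'rV[padic p]_d.
Local Notation Zp := (padic_integers p).

Lemma padic_ball_open (x : padic p) k :
  open [set x + p%:R ^+ k * z | z in Zp].
Proof.
move=> _ [z Zz <-]; exists k => w Zw; exists (z + w); last by rewrite mulrDr addrA.
exact: padic_integersD.
Qed.

Lemma row_openP (A : set T) : open A <->
  forall w, A w -> exists k : nat, forall x : T, (forall i, Zp (x 0 i)) ->
    A (w + p%:R ^+ k *: x).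
Proof.
split=> [Ao w Aw|h].
  have [P Pw PA] : nbhs w A by exact: open_nbhs_nbhs.
  have /choice[k kP] : forall i, exists k : nat,
      forall z, Zp z -> P 0 i (w 0 i + p%:R ^+ k * z).
    move=> i; have [B [Bo Bw BP]] := Pw 0 i.
    by have [k kB] := Bo _ Bw; exists k => z /kB /BP.
  (* The sum of the exponents is at least each of them, so one power of [p] serves every
     coordinate. *)
  exists (\sum_i k i)%N => x Zx; apply: PA => i j; rewrite !mxE (ord1 i).
  rewrite (bigD1 j)//= exprD -mulrA; apply: kP.
  exact: of_padic_intM_nat.
rewrite openE => w /h[k kA]; rewrite /interior.
exists (fun i j => [set w i j + p%:R ^+ k * z | z in Zp]).
  move=> i j; apply: open_nbhs_nbhs; split; first exact: padic_ball_open.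
  by exists 0; [exact: (padic_integers_nat p 0)|rewrite mulr0 addr0].
move=> M MP.
have /choice[z zP] : forall i, exists z, Zp z /\ w 0 i + p%:R ^+ k * z = M 0 i.
  by move=> i; have [z Zz zE] := MP 0 i; exists z.
have -> : M = w + p%:R ^+ k *: \row_i z i.
  by apply/rowP => i; rewrite !mxE; have [_ ->] := zP i.
by apply: kA => i; rewrite mxE; have [] := zP i.
Qed.

Lemma row_open_translate (t : T) (A : set T) : open A -> open (+%R t @^-1` A).
Proof.
move=> /row_openP Ao; apply/row_openP => w /Ao[k kA]; exists k => x Zx.
by rewrite /= addrA; exact: kA.
Qed.

End RowTopology.

Lemma open_borel (T : ptopologicalType) (A : set T) :
  open A -> measurable (A : set (borel T)).
Proof. by move=> Ao; exact: sub_sigma_algebra. Qed.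

(** * Integration against a translation-invariant measure *)

Section HaarIntegral.
Variables (R : realType) (p : prime_nat) (d : nat).
Local Notation T := 'rV[padic p]_d.
Variable mu : {measure set (borel T) -> \bar R}.
Hypothesis muH : haar_measure mu +%R.

Lemma measurable_row_translate (t : T) :
  measurable_fun setT (fun x : borel T => (t + x : borel T)).
Proof.
apply: (@measurability _ _ (borel T) (borel T) setT _ (@open T)) => //= _ [A Ao <-]; rewrite setTI.
by apply: open_borel; exact: row_open_translate.
Qed.

Lemma ge0_haar_integral_translate (t : T) (f : borel T -> \bar R) :
  measurable_fun [set: borel T] f -> (forall x, 0 <= f x)%E ->
  (\int[mu]_x f (t + x)%R = \int[mu]_x f x)%E.
Proof.
move=> mf f0; have [muE _ _] := muH.
pose phi (x : borel T) : borel T := t + x.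
transitivity (\int[pushforward mu phi]_x f x)%E.
  by rewrite (ge0_integral_pushforward (measurable_row_translate t)).
apply: eq_measure_integral => [|mphi A mA _]; first exact: measurable_row_translate.
(* Invariance is stated for images, so the preimage of [A] under translation by [t] is rewritten as
   its image under translation by [- t]. *)
rewrite -[RHS](muE (- t) A mA) /pushforward.
congr (mu _); apply/seteqP; split=> x /=.
  by move=> tx; exists (t + x) => //; rewrite addKr.
by move=> [y Ay <-]; rewrite /phi addNKr.
Qed.

(* The positive and negative parts of [f] have the same integral; if it is
   infinite, the junk value [fine (+oo - +oo) = 0] gives the conclusion. *)
Lemma haar_Rintegral_translate_opp (t : T) (f : borel T -> R) :
  measurable_fun [set: borel T] f -> (forall x : T, f (t + x) = - f x) ->
  \int[mu]_x f x = 0.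
Proof.
move=> mf fN; rewrite /Rintegral integralE.
have mfE : measurable_fun setT (EFin \o f) by exact/measurable_EFinP.
have -> : (EFin \o f)^\-%E = (fun x : T => (EFin \o f)^\+%E (t + x)).
  by apply/funext => x; rewrite funeposE funenegE /= fN.
rewrite ge0_haar_integral_translate//; last exact: measurable_funepos.
by case: (\int[mu]_x _)%E => [r| |] //=; rewrite subrr.
Qed.

End HaarIntegral.

(** * Parity of 2-adic integers and the volume of balls *)

Lemma padic2_odd_split (x : padic_int prime2) :
  (exists y, x = 2 * y) \/ (exists y, x = 1 + 2 * y).
Proof.
have [y xE] := padic_int_split x 1%N.
have := ltz_pmod (x 1%N) (isT : (0 : int) < 2).
have := modz_ge0 (x 1%N) (isT : (2 : int) != 0).
have := residue_mod x 1%N; rewrite expr1 => -> x0 x2.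
have {x2 x0} : x 1%N = 0 \/ x 1%N = 1 by lia.
move: (x 1%N) xE => r -> [->|->].
  by left; exists y; rewrite add0r expr1.
by right; exists y; rewrite expr1.
Qed.

Lemma padic2_half_notin : ~ padic_integers prime2 2^-1.
Proof.
move=> h; have := padic_integers_intV prime2 1 1.
by rewrite mul1r expr1 => /(_ h).
Qed.

(** By parity, each ball [B k] is the disjoint union of [B k.+1] and its translate by [2 ^ k]; these
    have equal volume, so the volume halves at each step. *)
Lemma haar_padic2_ball (R : realType)
    (mu : {measure set (borel (padic prime2)) -> \bar R}) k :
  haar_measure mu +%R -> mu (padic_integers prime2) = 1%E ->
  mu [set 2 ^+ k * z | z in padic_integers prime2] = (2 ^- k)%:E.
Proof.
move=> [muE _ _] mu1; set Zp := padic_integers prime2 in mu1 *.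
pose B k : set (padic prime2) := [set 2 ^+ k * z | z in Zp].
have two0 : 2 != 0 :> padic prime2 by exact: padic_natS_neq0.
have mB j : measurable (B j : set (borel (padic prime2))).
  apply: open_borel; have := padic_ball_open prime2 0 j.
  by rewrite /B; under eq_fun do rewrite add0r.
rewrite -/(B k).
elim: k => [|k IH].
  rewrite expr0 invr1 -mu1; congr (mu _); apply/seteqP; split=> z.
    by move=> [w Zw <-]; rewrite expr0 mul1r.
  by move=> Zz; exists z; rewrite // expr0 mul1r.
have BE : B k = B k.+1 `|` [set 2 ^+ k + z | z in B k.+1].
  apply/seteqP; split=> z.
    move=> [w [x _ <-] <-].
    case: (padic2_odd_split x) => -[y ->].
      left; exists (of_padic_int y); first exact: padic_integers_of.
      by rewrite rmorphM rmorph_nat mulrA -exprSr.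
    right; exists (2 ^+ k.+1 * of_padic_int y).
      by exists (of_padic_int y) => //; exact: padic_integers_of.
    by rewrite rmorphD rmorph1 rmorphM rmorph_nat mulrDr mulr1 mulrA -exprSr.
  case=> [[w Zw <-]|[_ [w Zw <-] <-]].
    exists (2 * w); last by rewrite mulrA -exprSr.
    by apply: padic_integersM => //; exact: padic_integers_nat.
  exists (1 + 2 * w); last by rewrite mulrDr mulr1 mulrA -exprSr.
  apply: padic_integersD; first exact: (padic_integers_nat _ 1).
  by apply: padic_integersM => //; exact: padic_integers_nat.
have mB' : measurable ([set 2 ^+ k + z | z in B k.+1] : set (borel (padic prime2))).
  apply: open_borel; rewrite /B image_comp.
  exact: (padic_ball_open prime2 (2 ^+ k) k.+1).
have dB : [disjoint B k.+1 & [set 2 ^+ k + z | z in B k.+1]].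
  apply/disj_setPS => _ [[z Zz <-] [_ [w Zw <-]]].
  rewrite exprSr -!mulrA -[X in X + _]mulr1 -mulrDr => /(mulfI (expf_neq0 k two0)).
  move=> /eqP; rewrite eq_sym -subr_eq -mulrBr => /eqP e; apply: padic2_half_notin.
  have -> : 2^-1 = z - w by apply: (mulfI two0); rewrite divff// e.
  exact: padic_integersB.
have : mu (B k) = (mu (B k.+1) + mu [set (2 ^+ k + z)%R | z in B k.+1])%E.
  by rewrite {1}BE; apply: measureU => //; exact/disj_set2P.
rewrite IH (muE (2 ^+ k) _ (mB k.+1)).
(* The two equal volumes add up to a finite number, which leaves only the finite case [r + r]. *)
case: (mu _) => [r| |] //= [rr]; congr (_%:E).
rewrite exprS invfM rr.
by field.
Qed.

(** * The localized space, lattice and bilinear form in coordinates along [v] *)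

Section Localization.
Variables (p : prime_nat) (V : vectType rat).
Local Notation Vp := (localization p V).
Local Notation Zp := (padic_integers p).
Local Notation loc := (@to_localization p V).
Local Notation e := (vbasis {:V}).

Lemma to_localizationD u w : loc (u + w) = loc u + loc w.
Proof. by apply/rowP => i; rewrite !mxE linearD/= padic_ratrD. Qed.

Lemma to_localizationZ r u : loc (r *: u) = ratr r *: loc u.
Proof. by apply/rowP => i; rewrite !mxE linearZ/= padic_ratrM. Qed.

Lemma to_localization_sum (I : Type) (r : seq I) (f : I -> V) :
  loc (\sum_(i <- r) f i) = \sum_(i <- r) loc (f i).
Proof.
apply: (big_morph _ to_localizationD).
by rewrite -(scale0r 0) to_localizationZ (ratr_nat _ 0) scale0r.
Qed.

Lemma to_localizationMz u (k : int) : loc (u *~ k) = k%:~R *: loc u.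
Proof. by rewrite -scaler_int to_localizationZ ratr_int. Qed.

Lemma to_localization_basis (i : 'I_(\dim {:V})) : loc e`_i = delta_mx 0 i.
Proof.
apply/rowP => j; rewrite !mxE eqxx/= coord_free ?(basis_free (vbasisP _))//.
by rewrite ratr_nat eq_sym.
Qed.

Lemma padic_integers_scale_fin (I : finType) (f : I -> padic p) :
  exists k : nat, forall i, Zp (p%:R ^+ k * f i).
Proof.
have /choice[k kP] : forall i, exists k : nat, Zp (p%:R ^+ k * f i).
  by move=> i; exact: padic_integers_scale.
exists (\sum_i k i)%N => i; rewrite (bigD1 i)//= addnC exprD -mulrA.
exact: of_padic_intM_nat.
Qed.

Section Coordinates.
Variables (n : nat) (v : n.-tuple V).

(** Coordinates [y] refer to the lattice basis [v], while the entries of a vector of [Vp] refer to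
    [vbasis]; this map passes from the former to the latter. *)
Definition lattice_comb (y : 'I_n -> padic p) : Vp :=
  \sum_j y j *: loc (tnth v j).

Lemma lattice_combD y z :
  lattice_comb (fun j => y j + z j) = lattice_comb y + lattice_comb z.
Proof. by rewrite -big_split/=; apply: eq_bigr => j _; rewrite scalerDl. Qed.

Lemma lattice_combZ r y : lattice_comb (fun j => r * y j) = r *: lattice_comb y.
Proof. by rewrite scaler_sumr; apply: eq_bigr => j _; rewrite scalerA. Qed.

Lemma local_lattice_spanP w : local_lattice p (int_span v) w <->
  exists2 y, (forall j, Zp (y j)) & w = lattice_comb y.
Proof.
split=> [[m [z [l [Ll ->]]]]|[y Zy ->]].
  have /choice[k kP] := Ll.
  exists (fun j => \sum_i of_padic_int (z i) * (k i j)%:~R).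
    move=> j; apply: padic_integers_sum => i.
    by apply: padic_integersM; [exact: padic_integers_of|exact: padic_integers_int].
  rewrite /lattice_comb; under [RHS]eq_bigr do rewrite scaler_suml.
  rewrite exchange_big/=; apply: eq_bigr => i _.
  rewrite kP to_localization_sum scaler_sumr; apply: eq_bigr => j _.
  by rewrite to_localizationMz scalerA.
have /choice[z zP] : forall j, exists z, of_padic_int z = y j.
  by move=> j; have [z _ zE] := Zy j; exists z.
exists n, z, (tnth v); split; last by apply: eq_bigr => j _; rewrite zP.
move=> i; exists (fun j => (j == i)%:Z); rewrite (bigD1 i)//= eqxx mulr1z.
by rewrite big1 ?addr0// => j /negbTE ->; rewrite mulr0z.
Qed.

(** The matrix expressing [vbasis] through [v] has finitely many entries, so one power of [p] clears
    their denominators. This is what makes the localized lattice open. *)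
Lemma local_lattice_nbhs0 : basis_of {:V} v ->
  exists k : nat, forall x : Vp, (forall i, Zp (x 0 i)) ->
    local_lattice p (int_span v) (p%:R ^+ k *: x).
Proof.
move=> vB.
have [k kP] := @padic_integers_scale_fin _
  (fun ij : 'I_(\dim {:V}) * 'I_n => ratr (coord v ij.2 e`_ij.1)).
exists k => x Zx; apply/local_lattice_spanP.
exists (fun j => \sum_(i < \dim {:V}) p%:R ^+ k * ratr (coord v j e`_i) * x 0 i).
  by move=> j; apply: padic_integers_sum => i; apply: padic_integersM => //; exact: (kP (i, j)).
rewrite /lattice_comb; under eq_bigr do rewrite scaler_suml.
rewrite exchange_big/= [x in LHS]row_sum_delta scaler_sumr; apply: eq_bigr => i _.
rewrite -to_localization_basis [in LHS](coord_basis vB (memvf e`_i)).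
rewrite to_localization_sum !scaler_sumr; apply: eq_bigr => j _.
by rewrite to_localizationZ !scalerA mulrAC (tnth_nth 0).
Qed.

End Coordinates.
Arguments lattice_comb {n} v y.

Section Form.
Variable b : V -> V -> rat.
Hypothesis bDl : forall u u' w, b (u + u') w = b u w + b u' w.
Hypothesis bZl : forall r u w, b (r *: u) w = r * b u w.
Hypothesis bC : forall u w, b u w = b w u.

Let b_suml (I : Type) (r : seq I) (f : I -> V) w :
  b (\sum_(i <- r) f i) w = \sum_(i <- r) b (f i) w.
Proof.
apply: (big_morph (b ^~ w)) => [u u'|]; first exact: bDl.
by rewrite -(scale0r 0) bZl mul0r.
Qed.

Let G : 'M[padic p]_(\dim {:V}) := \matrix_(i, j) ratr (b e`_i e`_j).

Lemma local_formE x y : local_form b x y = (x *m G *m y^T) 0 0.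
Proof.
rewrite mxE /local_form exchange_big/=; apply: eq_bigr => j _; rewrite !mxE mulr_suml.
by apply: eq_bigr => i _; rewrite mxE mulrAC.
Qed.

Lemma local_form_to_localization u w : local_form b (loc u) (loc w) = ratr (b u w).
Proof.
rewrite {2}(coord_vbasis (memvf u)) b_suml padic_ratr_sum.
apply: eq_bigr => i _; rewrite bZl bC [in RHS](coord_vbasis (memvf w)).
rewrite b_suml padic_ratrM padic_ratr_sum mulr_sumr; apply: eq_bigr => j _.
by rewrite bZl padic_ratrM !mxE mulrA bC.
Qed.

Lemma local_form_lattice_comb n (v : n.-tuple V) (a : 'I_n -> nat) y z :
  (forall i j, b (tnth v i) (tnth v j) = if i == j then (a i)%:R else 0) ->
  local_form b (lattice_comb v y) (lattice_comb v z) =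
  \sum_j (a j)%:R * (y j * z j).
Proof.
move=> bE; rewrite local_formE /lattice_comb !mulmx_suml summxE.
apply: eq_bigr => i _; rewrite linear_sum/= mulmx_sumr summxE (bigD1 i)//=.
have eE j : (y i *: loc (tnth v i) *m G *m (z j *: loc (tnth v j))^T) 0 0
    = y i * z j * (if i == j then (a i)%:R else 0).
  rewrite linearZ/= -!scalemxAl -scalemxAr scalerA mxE -local_formE.
  rewrite local_form_to_localization bE.
  by case: eqP => _; rewrite (ratr_nat, ratr_nat _ 0).
rewrite eE eqxx mulrC big1 ?addr0// => j ij.
by rewrite eE eq_sym (negbTE ij) mulr0.
Qed.

End Form.
End Localization.
Arguments lattice_comb {p V n} v y.

Lemma cintegral_char_fun (R : realType) d (T : measurableType d)
    (mu : {measure set T -> \bar R}) (A : set T) :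
  measurable A -> cintegral mu (char_fun R A) = Complex (fine (mu A)) 0.
Proof.
move=> mA; rewrite /cintegral /=; congr Complex.
  by rewrite /Rintegral integral_indic// setIT.
by rewrite /Rintegral integral0.
Qed.

(** The integer [2 * z] must be odd, say [1 + 2 * y], and then [z - 1/2 = y]. *)
Lemma padic2_double_integral (z : padic prime2) : ~ padic_integers prime2 z ->
  padic_integers prime2 (2 * z) -> padic_integers prime2 (z - 2^-1).
Proof.
have two0 : 2 != 0 :> padic prime2 by exact: padic_natS_neq0.
move=> nz [x _ xE]; case: (padic2_odd_split x) => -[y yE].
  case: nz; exists y => //; apply: (mulfI two0).
  by rewrite -xE yE rmorphM rmorph_nat.
exists y => //; apply: (mulfI two0).
rewrite mulrBr divff// -xE yE rmorphD rmorph1 rmorphM rmorph_nat.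
by rewrite addrAC subrr add0r.
Qed.

Lemma padic2_odd_inv (m : nat) : odd m ->
  exists y : padic prime2, padic_integers prime2 y /\ y * m%:R = 1.
Proof.
move=> om; have [|y yE] := @padic_int_unit prime2 m%:R.
  by rewrite (residue_int prime2 m) expr1 modz_nat modn2 om.
exists (of_padic_int y); split; first exact: padic_integers_of.
by rewrite -(rmorph_nat (@of_padic_int prime2)) -rmorphM yE rmorph1.
Qed.

(** * Polynomial identities behind the coset computations *)

Section Identities.
Variable A : comNzRingType.

(** For one coordinate [x - r] of a coset vector with [r = c / N] and [N = 2 * M], the factor
    [2 * M * r] on the right equals [c], so the denominators disappear. *)
Lemma value_identity (M a x r : A) :
  M * (a * ((x - r) * (x - r))) - M * (a * (r * r))
  = a * (M * (x * x) - 2 * M * r * x).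
Proof. by ring. Qed.

Lemma shift_identity (M a x r s u : A) :
  M * (a * ((x - r + s * u) * (x - r + s * u))) - M * (a * ((x - r) * (x - r)))
  = s * (a * (u * (2 * M * x - 2 * M * r + M * s * u))).
Proof. by ring. Qed.

(** Used from right to left, this isolates the change of the quadratic form as a separate summand in
    the argument of the character. *)
Lemma shift_split (s y z t : A) : s * (y - t) + s * (z - y) = s * (z - t).
Proof. by ring. Qed.

Lemma odd_identity (a c e i m M x : A) : M = 2 * m -> - (a * c) = 1 + 2 * i ->
  a * (2 * M * x - c + M * e) = 1 + 2 * (a * M * x + i + a * m * e).
Proof. by move=> -> acE; rewrite [RHS]addrC; ring: acE. Qed.

End Identities.

(** * The quadratic form and the integrand on the coset *)

Section CosetForm.
Variables (V : vectType rat) (b : V -> V -> rat).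
Hypothesis bDl : forall u u' w, b (u + u') w = b u w + b u' w.
Hypothesis bZl : forall r u w, b (r *: u) w = r * b u w.
Hypothesis bC : forall u w, b u w = b w u.
Variables (n : nat) (v : n.-tuple V) (a : 'I_n -> nat) (c k : int) (M : nat).
Variable h : rat.
Hypothesis bE : forall i j, b (tnth v i) (tnth v j) = if i == j then (a i)%:R else 0.
Hypothesis M_gt0 : (0 < M)%N.
Let rho : rat := c%:~R / (2 * M)%:R.
Hypothesis hE : h = \sum_(j < n) (a j)%:R * rho ^+ 2 + k%:~R / M%:R.

Local Notation Qp := (padic prime2).
Local Notation Zp := (padic_integers prime2).
Local Notation Vp := (localization prime2 V).
Local Notation comb := (@lattice_comb prime2 V n v).
Let nu : V := - rho *: \sum_(j < n) tnth v j.
Local Notation X := (local_coset prime2 (int_span v) nu).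
Local Notation Q w := (local_form b w w).
Let r : Qp := ratr rho.

Let twoMr : 2 * M%:R * r = c%:~R.
Proof.
rewrite -[2 in LHS](ratr_nat _ 2) -(ratr_nat _ M) -!padic_ratrM -(ratr_int _ c).
congr ratr; rewrite /rho natrM mulrC mulfVK// mulf_neq0 ?pnatr_eq0//.
by rewrite -lt0n.
Qed.

Let M0 : M%:R != 0 :> Qp.
Proof. by case: M M_gt0 => // m _; exact: padic_natS_neq0. Qed.

Lemma local_coset_combP w : X w <->
  exists2 x : 'I_n -> Qp, (forall j, Zp (x j)) & w = comb (fun j => x j - r).
Proof.
have nuE : to_localization prime2 nu = comb (fun=> - r).
  rewrite to_localizationZ padic_ratrN to_localization_sum scaler_sumr.
  by [].
split=> [[_ /local_lattice_spanP[x Zx ->] <-]|[x Zx ->]].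
  by exists x => //; rewrite nuE -lattice_combD.
exists (comb x); last by rewrite nuE -lattice_combD.
by apply/local_lattice_spanP; exists x.
Qed.

Lemma local_coset_translate (u : 'I_n -> Qp) w :
  (forall j, Zp (u j)) -> X (comb u + w) <-> X w.
Proof.
have imp (u' : 'I_n -> Qp) w' : (forall j, Zp (u' j)) -> X w' -> X (comb u' + w').
  move=> Zu /local_coset_combP[x Zx ->]; apply/local_coset_combP.
  exists (fun j => u' j + x j); first by move=> j; exact: padic_integersD.
  rewrite -lattice_combD; congr lattice_comb; apply/funext => j.
  by rewrite addrA.
move=> Zu; split; last exact: imp.
move=> /(imp (fun j => -1 * u j)); rewrite lattice_combZ scaleN1r addKr; apply.
by move=> j; rewrite mulN1r; exact: padic_integersN.
Qed.

Lemma local_form_coset_integral w : X w -> Zp (M%:R * (Q w - ratr h)).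
Proof.
move=> /local_coset_combP[x Zx ->].
rewrite (@local_form_lattice_comb _ _ _ bDl bZl bC _ _ _ _ _ bE).
have -> : ratr h = \sum_j (a j)%:R * (r * r) + k%:~R / M%:R :> Qp.
  rewrite hE padic_ratrD padic_ratr_sum; congr (_ + _).
    by apply: eq_bigr => j _; rewrite padic_ratrM ratr_nat expr2 padic_ratrM.
  by rewrite (padic_ratr_frac _ k M)// -lt0n.
rewrite opprD addrA mulrBr mulrBr [M%:R * (k%:~R / _)]mulrC mulfVK//.
apply: padic_integersB; last exact: padic_integers_int.
rewrite !mulr_sumr -sumrB; apply: padic_integers_sum => j.
rewrite value_identity twoMr.
apply: padic_integersM; first exact: padic_integers_nat.
apply: padic_integersB; apply: padic_integersM => //.
- exact: padic_integers_nat.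
- exact: padic_integersM.
- exact: padic_integers_int.
Qed.

Lemma local_form_coset_shift (x u : 'I_n -> Qp) s :
  M%:R * (Q (s *: comb u + comb (fun j => x j - r)) - Q (comb (fun j => x j - r)))
  = s * \sum_j (a j)%:R * (u j * (2 * M%:R * x j - c%:~R + M%:R * s * u j)).
Proof.
rewrite [s *: _ + _]addrC -lattice_combZ -lattice_combD.
rewrite !(@local_form_lattice_comb _ _ _ bDl bZl bC _ _ _ _ _ bE) mulrBr !mulr_sumr -sumrB.
by apply: eq_bigr => j _; rewrite shift_identity twoMr.
Qed.

Variable R : realType.
Let f (s : Qp) (w : Vp) : R[i] := padic_char R (s * (Q w - ratr h)) * char_fun R X w.

Let sE s (z : Qp) : s * z = s / M%:R * (M%:R * z).
Proof. by rewrite mulrA mulfVK. Qed.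

Let f_out s w : ~ X w -> f s w = 0.
Proof. by move=> nX; rewrite /f /char_fun indicE memNset// mulr0. Qed.

Let f_in s w : X w -> f s w = padic_char R (s * (Q w - ratr h)).
Proof. by move=> Xw; rewrite /f /char_fun indicE mem_set// mulr1. Qed.

Lemma integrand_integral s : Zp (s / M%:R) -> f s = char_fun R X.
Proof.
move=> Zs; apply/funext => w; have [Xw|nX] := pselect (X w); last first.
  by rewrite f_out// /char_fun indicE memNset.
rewrite f_in// padic_char_int; first by rewrite /char_fun indicE mem_set.
by rewrite sE; apply: padic_integersM => //; exact: local_form_coset_integral.
Qed.

(** If [2 ^ K] clears the denominator of [s / M], then translation by [2 ^ K] times a lattice vector
    changes the argument of the character by an integer. This is what gives measurability of the
    integrand. *)
Lemma integrand_locally_constant s : exists K : nat,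
  forall (u : 'I_n -> Qp) w, (forall j, Zp (u j)) ->
    f s (2 ^+ K *: comb u + w) = f s w.
Proof.
have [K ZK] := padic_integers_scale prime2 (s / M%:R).
exists K => u w Zu; rewrite -lattice_combZ.
have Zu' j : Zp (2 ^+ K * u j) by exact: (@of_padic_intM_nat prime2).
have Xiff := local_coset_translate _ w Zu'.
have [Xw|nX] := pselect (X w); last by rewrite !f_out// => /Xiff.
have Xw' : X (comb (fun j => 2 ^+ K * u j) + w) by apply/Xiff.
rewrite !f_in//; move: Xw => /local_coset_combP[x Zx wE].
rewrite lattice_combZ wE.
rewrite -(shift_split _ s (Q (comb (fun j => x j - r)))).
rewrite padic_charD_int// sE local_form_coset_shift mulrA.
apply: padic_integersM; first by rewrite mulrC.
apply: padic_integers_sum => j.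
apply: padic_integersM; first exact: padic_integers_nat.
apply: padic_integersM => //.
have ZM : Zp M%:R by exact: padic_integers_nat.
have Z2 m : Zp m%:R by exact: padic_integers_nat.
apply: padic_integersD.
  apply: padic_integersB; last exact: padic_integers_int.
  by apply: padic_integersM => //; apply: padic_integersM.
apply: padic_integersM => //; apply: padic_integersM => //.
exact: padic_integersX.
Qed.

Hypothesis M_even : ~~ odd M.
Hypothesis c_odd : odd `|c|%N.

Lemma integrand_antiinvariant j s : odd (a j) -> ~ Zp (s / M%:R) ->
  exists t, forall w, f s (t + w) = - f s w.
Proof.
move=> aj nZs; set t := s / M%:R in nZs.
have Z_ m : Zp m%:R by exact: padic_integers_nat.
have [m [nZm ZSm]] : exists m, ~ Zp (2 ^+ m * t) /\ Zp (2 ^+ m.+1 * t).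
  have ex : exists m, `[< Zp (2 ^+ m * t) >].
    by have [m Zm] := padic_integers_scale prime2 t; exists m; apply/asboolP.
  (* As [t] itself is not integral, the least exponent making it integral is a successor [m.+1]. *)
  case: (ex_minnP ex) => -[|m] /asboolP Zm mmin.
    by move: Zm; rewrite expr0 mul1r.
  exists m; split=> // /asboolP /mmin; by rewrite ltnn.
have Zh : Zp (2 ^+ m * t - 2^-1).
  by apply: padic2_double_integral => //; rewrite mulrA -exprS.
(* These are the coordinates of the basis vector with index [j]. *)
pose u (i : 'I_n) : Qp := (i == j)%:R.
have Zu i : Zp (u i) by exact: Z_.
exists (2 ^+ m *: comb u) => w; rewrite -lattice_combZ.
have Zu' i : Zp (2 ^+ m * u i) by exact: (@of_padic_intM_nat prime2).
have Xiff := local_coset_translate _ w Zu'.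
have [Xw|nX] := pselect (X w); last by rewrite !f_out ?oppr0// => /Xiff.
have Xw' : X (comb (fun i => 2 ^+ m * u i) + w) by apply/Xiff.
rewrite !f_in//; move: Xw => /local_coset_combP[x Zx wE].
rewrite lattice_combZ wE.
rewrite -(shift_split _ s (Q (comb (fun i => x i - r)))).
rewrite padic2_charD_half// sE -/t local_form_coset_shift mulrA.
rewrite (bigD1 j)//= big1 ?addr0; last first.
  by move=> i ij; rewrite /u (negbTE ij) mul0r mulr0.
rewrite /u eqxx mul1r mulr1 mulrC (mulrC t).
(* The cofactor of [2 ^ m * t] is odd: [a j * c] is odd, and every other term contains the even
   number [M]. *)
have [y Zy ->] : exists2 y, Zp y &
    (a j)%:R * (2 * M%:R * x j - c%:~R + M%:R * 2 ^+ m) = 1 + 2 * y.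
  have [i iE] : exists i : int, - ((a j)%:Z * c) = 1 + 2 * i.
    have : odd `|((a j)%:Z * c)%R|%N by rewrite abszM oddM absz_nat aj.
    move: ((a j)%:Z * c)%R => z oz; exists ((- z - 1) %/ 2)%Z; lia.
  have acE : - ((a j)%:R * c%:~R) = 1 + 2 * i%:~R :> Qp.
    by have := congr1 (intmul (1 : Qp)) iE; rewrite mulrNz intrD !intrM.
  have ME : M%:R = 2 * M./2%:R :> Qp.
    by rewrite -natrM mul2n even_halfK.
  exists ((a j)%:R * M%:R * x j + i%:~R + (a j)%:R * M./2%:R * 2 ^+ m).
    apply: padic_integersD; first apply: padic_integersD.
    - by apply: padic_integersM => //; apply: padic_integersM.
    - exact: padic_integers_int.
    - apply: padic_integersM; first exact: padic_integersM.
      exact: padic_integersX.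
  exact: odd_identity.
rewrite mulrDl mul1r addrAC; apply: padic_integersD => //.
(* The even part of the cofactor contributes [2 ^ m.+1 * t * y], integral by the choice of [m]; the
   odd part left [2 ^ m * t - 1/2], treated by [Zh]. *)
rewrite mulrAC (mulrA 2) -exprS.
exact: padic_integersM.
Qed.

Hypothesis v_basis : basis_of {:V} v.

(** Around every point [f s] is constant on a translate of a scaled lattice, which contains a
    neighborhood of that point; hence all preimages are open. *)
Lemma measurable_integrand s (g : R[i] -> R) :
  measurable_fun [set: borel Vp] (fun w : borel Vp => g (f s w)).
Proof.
move=> _ A _; rewrite setTI; apply: open_borel; apply/row_openP => w Aw.
have [K KP] := integrand_locally_constant s.
have [l lP] := local_lattice_nbhs0 prime2 _ _ _ v_basis.
exists (K + l)%N => x /lP /local_lattice_spanP[u Zu uE].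
by rewrite /= exprD -scalerA uE addrC KP.
Qed.

Lemma measurable_local_lattice :
  measurable (local_lattice prime2 (int_span v) : set (borel Vp)).
Proof.
apply: open_borel; apply/row_openP => w /local_lattice_spanP[y Zy ->].
have [l lP] := local_lattice_nbhs0 prime2 _ _ _ v_basis.
exists l => x /lP /local_lattice_spanP[u Zu ->]; apply/local_lattice_spanP.
exists (fun j => y j + u j); last by rewrite lattice_combD.
by move=> j; exact: padic_integersD.
Qed.

Lemma measurable_local_coset : measurable (X : set (borel Vp)).
Proof.
apply: open_borel; apply/row_openP => w Xw.
have [l lP] := local_lattice_nbhs0 prime2 _ _ _ v_basis.
exists l => x /lP /local_lattice_spanP[u Zu ->].
by rewrite addrC; apply/(local_coset_translate _ w Zu).
Qed.

Lemma cintegral_integrand (muV : {measure set (borel Vp) -> \bar R}) j s :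
  odd (a j) -> haar_measure muV +%R ->
  muV (local_lattice prime2 (int_span v)) = 1%E ->
  cintegral muV (f s) = char_fun R [set s : Qp | Zp (s / M%:R)] s.
Proof.
move=> aj muH mu1; have [Zs|nZs] := pselect (Zp (s / M%:R)).
  rewrite integrand_integral// cintegral_char_fun; last exact: measurable_local_coset.
  have [muE _ _] := muH.
  have -> : muV X = 1%E.
    rewrite -mu1 -(muE (to_localization prime2 nu) _ measurable_local_lattice).
    by congr (muV _); apply/eq_imagel => x _; rewrite addrC.
  by rewrite /char_fun indicE mem_set.
have [t tP] := integrand_antiinvariant j s aj nZs.
rewrite /cintegral /char_fun indicE memNset//.
(* Translation by [t] reverses the sign of the real and of the imaginary part separately. *)
congr Complex; apply: (haar_Rintegral_translate_opp _ _ _ _ muH t).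
- exact: measurable_integrand.
- by move=> w; rewrite tP; case: (f s w).
- exact: measurable_integrand.
- by move=> w; rewrite tP; case: (f s w).
Qed.

End CosetForm.

(** * The domain of the outer integral and the value of the density *)

Lemma div_cancel_l (F : fieldType) (x m s : F) : x != 0 -> m != 0 ->
  x * (m * (s * (m^-1 * x^-1))) = s.
Proof. by move=> x0 m0; field; rewrite x0. Qed.

Lemma div_cancel_r (F : fieldType) (x y z : F) : x != 0 ->
  x * z * (y * x^-1) = z * y.
Proof. by move=> x0; field. Qed.

(** The odd number [m] is a unit of the 2-adic integers, so only the factor [2 ^ k] affects
    integrality. *)
Lemma padic2_integers_divn (m k : nat) (s : padic prime2) : odd m ->
  padic_integers prime2 (s / (m * 2 ^ k)%:R) <->
  exists2 z, padic_integers prime2 z & 2 ^+ k * z = s.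
Proof.
move=> om; have [y [Zy ym]] := padic2_odd_inv m om.
have m0 : m%:R != 0 :> padic prime2.
  by apply: contra_eq_neq ym => ->; rewrite mulr0 eq_sym oner_neq0.
have k0 : 2 ^+ k != 0 :> padic prime2 by rewrite (padic_p_neq0 prime2 k).
have yE : y = m%:R^-1 by apply: (mulIf m0); rewrite ym mulVf.
rewrite natrM natrX invfM -yE; split=> [Zs|[z Zz <-]].
  exists (m%:R * (s * (y * 2 ^- k))).
    by apply: padic_integersM => //; exact: padic_integers_nat.
  by rewrite yE div_cancel_l.
by rewrite div_cancel_r//; exact: padic_integersM.
Qed.

Theorem theorem3p10 (R : realType) (V : vectType rat) (b : {dot V for idfun})
    (n : nat) (v : n.-tuple V) (a : 'I_n -> nat) (c : int) (N : nat) (h : rat)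
    (muV : {measure set (borel (localization prime2 V)) -> \bar R})
    (muQ : {measure set (borel (padic prime2)) -> \bar R}) :
  let L : set V := int_span v in
  let nu : V := - (c%:~R / N%:R) *: \sum_(j < n) tnth v j in
  basis_of {:V} v ->
  ~~ odd n ->
  (forall i j, b (tnth v i) (tnth v j) = if i == j then (a i)%:R else 0) ->
  (forall j, (0 < a j)%N) ->
  \big[gcdn/0%N]_(j < n) a j = 1%N ->
  (0 < N)%N ->
  gcdz c N%:Z = 1 ->
  (exists k : int, h - \sum_(j < n) (a j)%:R * (c%:~R / N%:R) ^+ 2
                   = 8%:R * ((gcdn N 4)%:R * N%:R)^-1 * k%:~R) ->
  haar_measure muV +%R -> muV (local_lattice prime2 L) = 1%E ->
  haar_measure muQ +%R -> muQ (padic_integers prime2) = 1%E ->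
  (4 %| N)%N ->
  local_density b h (char_fun R (local_coset prime2 L nu)) muV muQ
    = 2%:R ^ (- ((logn 2 N)%:Z - 1)).
Proof.
move=> L nu vB _ bE _ agcd N0 cN [k hk] muVH muV1 muQH muQ1 N4.
(* If all the [a j] were even, 2 would divide their gcd. *)
have [j aj] : exists j, odd (a j).
  apply: contrapT => /forallNP ha.
  have : (2 %| \big[gcdn/0%N]_(j < n) a j)%N.
    apply: (big_ind (fun d => 2 %| d)%N) => //= [x y x2 y2|j _]; first by rewrite dvdn_gcd x2.
    by rewrite dvdn2; apply/negP.
  by rewrite agcd.
have c_odd : odd `|c|%N.
  apply: contraT; rewrite -dvdn2 => c2.
  have : (2 %| gcdn `|c| N)%N by rewrite dvdn_gcd c2 (dvdn_trans _ N4).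
  by move: cN; rewrite /gcdz /= => -[->].
(* As 4 divides [N], its 2-adic order is [e.+2] for some [e]; half of [N] then has order [e.+1] and
   is still even. *)
have [m om [e Nlog NE]] : exists2 m, odd m &
    exists2 e, logn 2 N = e.+2 & N = (2 * (m * 2 ^ e.+1))%N.
  have [m] := pfactor_coprime (isT : prime 2) N0; rewrite coprime2n => om NE.
  have : (2 <= logn 2 N)%N by rewrite -pfactor_dvdn.
  case El: (logn 2 N) NE => [|[|e]] // NE _; exists m => //; exists e => //.
  by rewrite mulnCA -expnS -NE.
set M := (m * 2 ^ e.+1)%N in NE.
have M0 : (0 < M)%N by rewrite muln_gt0 expn_gt0 odd_gt0.
have M_even : ~~ odd M by rewrite /M expnS oddM oddM andbF.
(* With [gcdn N 4 = 4] and [N = 2 * M], the coefficient [8 / (4 * N)] of [k] becomes [1 / M]. *)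
have hE : h = \sum_(j < n) (a j)%:R * (c%:~R / (2 * M)%:R) ^+ 2 + k%:~R / M%:R.
  move/eqP: hk; rewrite subr_eq addrC => /eqP ->; rewrite -NE; congr (_ + _).
  have -> : gcdn N 4 = 4%N by apply/gcdn_idPr.
  rewrite NE natrM; field.
  by rewrite pnatr_eq0 -lt0n.
have bDl u u' w : b (u + u') w = b u w + b u' w by rewrite linearDl.
have bZl r u w : b (r *: u) w = r * b u w by rewrite linearZl_LR.
have bC u w : b u w = b w u by rewrite hermC expr0 mul1r.
rewrite /local_density.
transitivity (cintegral muQ (char_fun R [set s | padic_integers prime2 (s / M%:R)])).
  congr cintegral; apply/funext => s; rewrite /nu NE.
  by rewrite (cintegral_integrand _ _ bDl bZl bC _ _ _ _ _ _ _ bE M0 hE _ M_even c_odd vB _ _ _ aj).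
have -> : [set s | padic_integers prime2 (s / M%:R)]
    = [set 2 ^+ e.+1 * z | z in padic_integers prime2].
  by apply/seteqP; split=> s /=; rewrite padic2_integers_divn.
rewrite cintegral_char_fun; last first.
  apply: open_borel; have := padic_ball_open prime2 0 e.+1.
  by under eq_fun do rewrite add0r.
rewrite haar_padic2_ball//= Nlog.
have -> : (e.+2%:Z - 1) = e.+1%:Z by lia.
rewrite -invr_expz -exprnP.
have -> : Complex (2 ^- e.+1) 0 = real_complex R (2 ^- e.+1) by [].
by rewrite fmorphV rmorphXn rmorph_nat.
Qed.
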